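(* Let $(q_k)_{k=2}^\infty$ be positive real numbers such that the power series $f(z)=1+z+\sum_{k=2}^\infty \frac{z^k}{q_2^{k-1}q_3^{k-2}\cdots q_k}$ is the generating function of a totally positive sequence. Then for every real $a>1$ with $a^2\ge 3.503$, the power series $$(f\ast g_a)(z)=1+z+\sum_{k=2}^\infty \frac{z^k}{a^{k(k-1)}\,q_2^{k-1}q_3^{k-2}\cdots q_k}$$ is also the generating function of a totally positive sequence.
   Context: A real sequence $(a_k)_{k=0}^\infty$ is called totally positive if all minors of the infinite upper triangular Toeplitz matrix $\|a_{j-i}\|_{i,j=0}^\infty$ are nonnegative, where $a_k=0$ for $k<0$. Its generating function is the (formal) power series $\sum_{k=0}^\infty a_k z^k$. The product $q_2^{k-1}q_3^{k-2}\cdots q_k$ means $\prod_{j=2}^k q_j^{\,k-j+1}$. For $a>1$, $g_a(z)=\sum_{j=0}^\infty z^j a^{-j(j-1)}$ is the partial theta-function, and $\ast$ denotes the coefficientwise (Hadamard) product of power series. *)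

(* Defs.v *)
From mathcomp Require Import all_boot all_order all_algebra.
From mathcomp Require Import reals.

Set Implicit Arguments.
Unset Strict Implicit.
Unset Printing Implicit Defensive.

Import Order.TTheory GRing.Theory Num.Theory.
Local Open Scope ring_scope.

(* A formal power series is represented by its coefficient sequence, so the
   generating function of a sequence is that sequence itself. *)
Definition fps (R : realType) : Type := nat -> R.

Section PowerSeries.
Variable R : realType.

(* Entry (i, j) is a_(j - i), with a_k = 0 for k < 0; the test is needed since
   the subtraction on nat is truncated. *)
Definition toeplitz (a : nat -> R) (i j : nat) : R :=
  if (i <= j)%N then a (j - i)%N else 0.

Definition increasing_idx (n : nat) (r : 'I_n -> nat) : Prop :=
  forall i j : 'I_n, (i < j)%N -> (r i < r j)%N.

Definition minor (M : nat -> nat -> R) (n : nat) (r c : 'I_n -> nat) : R :=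
  \det (\matrix_(i < n, j < n) M (r i) (c j)).

Definition totally_positive (a : nat -> R) : Prop :=
  forall (n : nat) (r c : 'I_n -> nat),
    increasing_idx r -> increasing_idx c -> 0 <= minor (toeplitz a) r c.

Definition hadamard (f g : fps R) : fps R := fun k => f k * g k.

Definition partial_theta (a : R) : fps R := fun j => (a ^+ (j * (j - 1)))^-1.

(* q_2^(k-1) q_3^(k-2) ... q_k; the product is empty, hence 1, for k = 0, 1. *)
Definition qprod (q : nat -> R) (k : nat) : R :=
  \prod_(2 <= j < k.+1) q j ^+ (k - j + 1).

(* The values q 0 and q 1 are never used. *)
Definition qseries (q : nat -> R) : fps R :=
  fun k => if (k < 2)%N then 1 else (qprod q k)^-1.

Definition qseries_theta (a : R) (q : nat -> R) : fps R :=
  fun k => if (k < 2)%N then 1 else (a ^+ (k * (k - 1)) * qprod q k)^-1.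

End PowerSeries.

(* Main.v *)
Require Import Defs.
From mathcomp Require Import all_boot all_order all_algebra.
From mathcomp Require Import reals.
From mathcomp Require Import ring lra zify.

(** For a positive sequence f, call u_j = f_(j-1) f_(j+1) / f_j^2 (with u_0 = 0)
    its curvature at j.  In terms of the q_k this is u_j = 1 / q_(j+1), and
    multiplying f by the partial theta function multiplies every curvature by
    A = a^-2.  Since 3.503 >= 7/2, we have A <= 2/7.

    If all curvatures of a polynomial P = sum_i p_i z^i are at most 1/4, a
    classical argument of Hutchinson shows that P has only negative roots: at
    the point x > 0 where the neighbours p_(j-1) x^(j-1) and p_(j+1) x^(j+1) of
    the j-th term agree, each equals y p_j x^j with y^2 the curvature at j, so
    y <= 1/2 and the j-th term outweighs both; the remaining terms alternate
    and decrease on either side.  Hence (-1)^j P(-x) >= 0, and these points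
    separate the roots.

    Here curvatures reach A > 1/4, and 1 - 2y may be slightly negative.  The
    second neighbours rescue the sign: they contribute y^2 times the sum of the
    curvatures at j-1 and j+1.  This sum is large because f is totally
    positive.  Its minors of order 2 give u_j <= 1, and its minors of order 3
    give
      u_j^2 (1 - u_(j-1)) (1 - u_(j+1)) <= (1 - u_j)^2    (curv_minor3).
    When A u_j > 1/4, the bound A <= 2/7 forces u_j >= 7/8, so the product
    (1 - u_(j-1)) (1 - u_(j+1)) is at most 1/49 and u_(j-1) + u_(j+1) >= 48/49
    (neighbour_curv_sum).  The three terms nearest to the j-th on each side then
    suffice (balanced_bound, balanced_value_gt0).

    A minor involves finitely many coefficients, so it is enough to treat
    polynomials that agree with the series up to a given degree.  Cutting the
    series abruptly would put a zero curvature next to one that may exceed 1/4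
    and destroy the estimate; one extra coefficient making the last curvature
    equal to 1/4 avoids this (trunc).

    Finally, a polynomial with positive leading coefficient and negative roots
    is a product of factors z + alpha with alpha >= 0, and multiplication by
    such a factor replaces each column of the Toeplitz matrix by a nonnegative
    combination of itself and its left neighbour, which preserves the sign of
    all minors (tp_mix_columns, tp_of_alternation). *)

Set Implicit Arguments.
Unset Strict Implicit.
Unset Printing Implicit Defensive.

Import Order.TTheory GRing.Theory Num.Theory.
Local Open Scope ring_scope.

(** * Total positivity of products of linear factors *)

Definition tp_matrix (R : realType) (M : nat -> nat -> R) : Prop :=
  forall (n : nat) (r c : 'I_n -> nat),
    increasing_idx r -> increasing_idx c -> 0 <= minor M r c.

(** The Toeplitz matrix of (al + be z) f, when M is that of f. *)
Definition mix_columns (R : realType) (al be : R) (M : nat -> nat -> R) :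
    nat -> nat -> R :=
  fun i j => al * M i j + be * (if j is j'.+1 then M i j' else 0).

Lemma det_column_linear (R : comNzRingType) n (A B C : 'M[R]_n) (j0 : 'I_n)
    (b c : R) :
  (forall i j, j != j0 -> A i j = B i j) ->
  (forall i j, j != j0 -> A i j = C i j) ->
  (forall i, A i j0 = b * B i j0 + c * C i j0) ->
  \det A = b * \det B + c * \det C.
Proof.
move=> AB AC Aj0; rewrite -det_tr -(det_tr B) -(det_tr C).
apply: (determinant_multilinear (i0 := j0)).
- by apply/rowP => i; rewrite !mxE.
- by apply/matrixP => i j; rewrite !mxE AB // eq_sym neq_lift.
- by apply/matrixP => i j; rewrite !mxE AC // eq_sym neq_lift.
Qed.

Lemma det_zero_column (R : comNzRingType) n (A : 'M[R]_n) (j0 : 'I_n) :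
  (forall i, A i j0 = 0) -> \det A = 0.
Proof.
move=> A0; rewrite (expand_det_col _ j0) big1 // => i _.
by rewrite A0 mul0r.
Qed.

(** The mixed columns are expanded one at a time from the left.  Each expansion
    either keeps an index or lowers it by one, so the chosen columns of M stay
    strictly increasing or two of them coincide, in which case the determinant
    vanishes. *)
Lemma tp_mix_columns (R : realType) (al be : R) (M : nat -> nat -> R) :
  0 <= al -> 0 <= be -> tp_matrix M -> tp_matrix (mix_columns al be M).
Proof.
move=> al0 be0 tpM n r c incr incc.
pose D m (e : 'I_n -> nat) : 'M[R]_n :=
  \matrix_(i, j) if (j < m)%N then M (r i) (e j)
                 else mix_columns al be M (r i) (e j).
(* D m e has its first m columns already replaced by columns of M. *)
suff detD m e : (m <= n)%N -> increasing_idx e -> 0 <= \det (D m e).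
  rewrite /minor; have := detD 0%N c (leq0n n) incc.
  by congr (0 <= \det _); apply/matrixP => i j; rewrite !mxE.
(* Induction on the number n - m of columns that remain mixed. *)
move=> lemn; rewrite -(subKn lemn); elim: (n - m)%N e => [|k IHk] e ince.
  rewrite subn0; have := tpM n r e incr ince.
  congr (0 <= \det _); apply/matrixP => i j.
  by rewrite !mxE ltn_ord.
case: (ltnP k n) => [ltkn|lenk]; last first.
  move: (IHk e ince); congr (0 <= \det (D _ _)).
  by apply/eqP; rewrite subnS; move: lenk; rewrite -subn_eq0 => /eqP ->.
rewrite subnS; set m' := (n - k)%N in IHk *.
have m'_gt0 : (0 < m')%N by rewrite subn_gt0.
have ltm : (m'.-1 < n)%N by rewrite prednK // leq_subr.
pose j0 := Ordinal ltm.
pose e' (j : 'I_n) := if j == j0 then (e j).-1 else e j.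
have ltj0 (j : 'I_n) : j != j0 -> (j < m')%N = (j < m'.-1)%N.
  move=> nej; rewrite -[in LHS](prednK m'_gt0) ltnS leq_eqVlt.
  by rewrite (_ : (j == m'.-1 :> nat) = false) //; apply/negbTE.
have [ej0|ej0] := posnP (e j0).
  suff -> : \det (D m'.-1 e) = al * \det (D m' e) + 0 * \det (D m' e).
    by rewrite mul0r addr0 mulr_ge0 // IHk.
  apply: (det_column_linear (j0 := j0)) => [i j nej|i j nej|i].
  - by rewrite !mxE ltj0.
  - by rewrite !mxE ltj0.
  - rewrite !mxE ltnn prednK // leqnn /mix_columns ej0; ring.
suff -> : \det (D m'.-1 e) = al * \det (D m' e) + be * \det (D m' e').
  apply: addr_ge0; first by rewrite mulr_ge0 // IHk.
  apply: mulr_ge0 => //.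
  (* A lowered index can collide only with its left neighbour. *)
  case: (boolP [exists j : 'I_n, (j < j0)%N && (e j == (e j0).-1)]).
    case/existsP=> j /andP[ltj /eqP ej].
    have nej : j != j0 by rewrite -val_eqE /= neq_ltn ltj.
    rewrite -[\det (D m' e')]det_tr (determinant_alternate nej) // => i.
    rewrite !mxE /e' (negbTE nej) eqxx -ej.
    by rewrite (ltn_trans ltj) /= prednK ?leqnn.
  rewrite negb_exists => /forallP nex; apply: IHk => i j ltij.
  rewrite /e'; have lte := ince i j ltij.
  case: eqP => [ei|_]; case: eqP => [ej|_] //.
  - by move: ltij; rewrite ei ej ltnn.
  - exact: leq_ltn_trans (leq_pred _) lte.
  - subst j; move: (nex i); rewrite ltij /= ltn_neqAle => -> /=.
    by rewrite -ltnS prednK.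
apply: (det_column_linear (j0 := j0)) => [i j nej|i j nej|i].
- by rewrite !mxE ltj0.
- by rewrite !mxE ltj0 // /e' (negbTE nej).
- rewrite !mxE ltnn prednK // leqnn /mix_columns /e' eqxx.
  by case: (e j0) ej0.
Qed.

(** Compare the first row index with the first column index: if they differ,
    the smaller one belongs to a zero row or column; if they agree, the first
    row is zero off the diagonal and the minor reduces to a smaller one. *)
Lemma tp_scalar (R : realType) (l : R) : 0 <= l ->
  tp_matrix (fun i j => if i == j then l else 0).
Proof.
move=> l0; elim=> [|n IHn] r c incr incc; first by rewrite /minor det_mx00.
have [lt0|] := ltnP (r ord0) (c ord0).
  rewrite /minor (expand_det_row _ ord0) big1 // => j _.
  rewrite !mxE; case: eqP => [e|_]; last by rewrite mul0r.
  have : (c ord0 <= c j)%N.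
    by case: (posnP j) => [j0|/(incc ord0)/ltnW //]; rewrite (_ : j = ord0) //; apply: val_inj.
  by rewrite -e leqNgt lt0.
rewrite leq_eqVlt => /predU1P[e0|lt0]; last first.
  rewrite /minor (@det_zero_column _ _ _ ord0) // => i.
  rewrite !mxE; case: eqP => [e|//].
  have : (r ord0 <= r i)%N.
    by case: (posnP i) => [i0|/(incr ord0)/ltnW //]; rewrite (_ : i = ord0) //; apply: val_inj.
  by rewrite e leqNgt lt0.
rewrite /minor (expand_det_row _ ord0) big_ord_recl big1 => [|j _].
  rewrite addr0 !mxE -e0 eqxx mulr_ge0 // /cofactor addn0 expr0 mul1r.
  have := IHn (fun i => r (lift ord0 i)) (fun i => c (lift ord0 i)).
  rewrite /minor (_ : \matrix_(_, _) _ = row' ord0 (col' ord0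
    (\matrix_(i, j) (if r i == c j then l else 0)))).
    by apply=> i j ltij; [apply: incr | apply: incc].
  by apply/matrixP => i j; rewrite !mxE.
rewrite !mxE; case: eqP => [e|_]; last by rewrite mul0r.
have : (c ord0 < c (lift ord0 j))%N by apply: incc.
by rewrite -e e0 ltnn.
Qed.

Lemma tp_prod_linear (R : realType) (l : R) (s : seq R) : 0 <= l ->
  (forall z, z \in s -> z <= 0) ->
  totally_positive (fun k => (l *: \prod_(z <- s) ('X - z%:P))`_k).
Proof.
move=> l0; elim: s => [|z s IHs] sneg n r c incr incc.
  have := tp_scalar l0 incr incc.
  congr (0 <= \det _); apply/matrixP => i j; rewrite !mxE /toeplitz.
  rewrite big_nil -mul_polyC mulr1 coefC subn_eq0.
  by case: (ltngtP (r i) (c j)).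
have tps : totally_positive (fun k => (l *: \prod_(w <- s) ('X - w%:P))`_k).
  by apply: IHs => w ws; apply: sneg; rewrite inE ws orbT.
have z0 : 0 <= - z by rewrite oppr_ge0 sneg // mem_head.
have := tp_mix_columns z0 ler01 tps incr incc.
congr (0 <= \det _); apply/matrixP => i j; rewrite !mxE.
rewrite /mix_columns /toeplitz big_cons scalerAr; set p := l *: _.
rewrite [('X - _) * p]mulrC mulrBr coefB coefMX coefMC.
case: (leqP (r i) (c j)) => [le_rc|lt_rc]; last first.
  case: (c j) lt_rc => [|m] lt_rc; first by rewrite !mulr0 addr0.
  by rewrite leqNgt (ltnW lt_rc) /= !mulr0 addr0.
case: (c j) le_rc => [|m] le_rc.
  by rewrite sub0n /= !mulr0 mulrC; ring.
have [->|lt_rm] := eqVneq (r i) m.+1.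
  by rewrite subnn ltnn /=; ring.
move: le_rc; rewrite leq_eqVlt (negbTE lt_rm) ltnS /= => le_rm.
by rewrite le_rm subSn //=; ring.
Qed.

(** * Sign alternation and real roots *)

Lemma poly_root_between (R : realType) (P : {poly R}) (u v : R) :
  u < v -> P.[u] * P.[v] < 0 -> exists2 z, u < z < v & root P z.
Proof.
move=> ltuv Puv.
have [P0|P0|P0] := ltgtP P.[u] 0.
- have Pv : 0 <= P.[v] by rewrite -(nmulr_rle0 _ P0) ltW.
  have [|z /andP[uz zv] rz] := @poly_ivt R P u v (ltW ltuv).
    by rewrite (ltW P0).
  exists z => //; move: rz => /eqP rz; rewrite !lt_neqAle uz zv !andbT.
  apply/andP; split; apply/eqP => e; move: Puv.
    by rewrite e rz mul0r ltxx.
  by rewrite -e rz mulr0 ltxx.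
- have Pv : P.[v] <= 0 by rewrite -(pmulr_rle0 _ P0) ltW.
  have [|z /andP[uz zv] rz] := @poly_ivt R (- P) u v (ltW ltuv).
    by rewrite !hornerN oppr_ge0 oppr_le0 Pv (ltW P0).
  exists z; last by rewrite -rootN.
  move: rz => /eqP; rewrite hornerN => /eqP; rewrite oppr_eq0 => /eqP rz.
  rewrite !lt_neqAle uz zv !andbT.
  apply/andP; split; apply/eqP => e; move: Puv.
    by rewrite e rz mul0r ltxx.
  by rewrite -e rz mulr0 ltxx.
- by move: Puv; rewrite P0 mul0r ltxx.
Qed.

Lemma roots_of_alternation (R : realType) (P : {poly R}) (d : nat)
    (x : nat -> R) :
  x 0%N = 0 -> (forall j, (j < d)%N -> x j < x j.+1) ->
  (forall j, (j <= d)%N -> 0 < (-1) ^+ j * P.[- x j]) ->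
  exists s : seq R, [/\ size s = d, uniq s, all (root P) s &
                        all (fun z => - x d < z < 0) s].
Proof.
move=> x0; elim: d => [|d IHd] xmono Palt; first by exists [::].
have [j ltj|j lej|s [ss us rs bs]] := IHd.
- by apply: xmono; apply: ltnW.
- by apply: Palt; apply: leqW.
have lt_xd : - x d.+1 < - x d by rewrite ltrN2 xmono.
have [|z /andP[xz zx] rz] := @poly_root_between R P _ _ lt_xd.
  have := mulr_gt0 (Palt d (leqnSn d)) (Palt d.+1 (leqnn _)).
  set A := P.[_]; set B := P.[_].
  have -> : (-1) ^+ d * A * ((-1) ^+ d.+1 * B) = ((-1) ^+ d) ^+ 2 * - (B * A).
    by rewrite exprS; ring.
  by rewrite sqrr_sign mul1r oppr_gt0.
have xd0 : 0 <= x d.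
  rewrite -x0; have: (d <= d)%N by []; elim: {-2}d => // m IHm ltm.
  by apply: le_trans (IHm (ltnW ltm)) (ltW (xmono _ _)); apply: leqW.
exists (z :: s); split => /=.
- by rewrite ss.
- rewrite us andbT; apply/negP => /(allP bs)/andP[h _].
  by move: (lt_trans h zx); rewrite ltxx.
- by rewrite rz.
- rewrite xz (lt_le_trans zx) ?oppr_le0 //=.
  by apply: sub_all bs => w /andP[w1 ->]; rewrite (lt_trans lt_xd).
Qed.

(** There are d sign changes on the negative half-line, hence d distinct negative
    roots; this exhausts the degree and gives the full factorization. *)
Lemma tp_of_alternation (R : realType) (p x : nat -> R) (d : nat) :
  0 < p d -> (forall i, (d < i)%N -> p i = 0) ->
  x 0%N = 0 -> (forall j, (j < d)%N -> x j < x j.+1) ->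
  (forall j, (j <= d)%N ->
     0 < (-1) ^+ j * \sum_(i < d.+1) (-1) ^+ i * (p i * x j ^+ i)) ->
  totally_positive p.
Proof.
move=> pd_gt0 p_eq0 x0 xmono palt.
pose P := \poly_(i < d.+1) p i.
have coefP i : P`_i = p i.
  by rewrite coef_poly ltnS; case: leqP => // /p_eq0 ->.
have sizeP : size P = d.+1 by apply: size_poly_eq; rewrite gt_eqF.
have [j lej|s [ss us rs bs]] := @roots_of_alternation R P d x x0 xmono.
  have := palt j lej; congr (0 < _ * _); rewrite horner_poly.
  by apply: eq_bigr => i _; rewrite [(- x j) ^+ i]exprNn; ring.
have defP : P = lead_coef P *: \prod_(z <- s) ('X - z%:P).
  by apply: all_roots_prod_XsubC => //; rewrite ?sizeP ?ss ?uniq_rootsE.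
have lc_ge0 : 0 <= lead_coef P.
  by rewrite lead_coefE sizeP coefP ltW.
have tpP := tp_prod_linear lc_ge0 (s := s).
move=> n r c incr incc; have := tpP _ n r c incr incc.
rewrite -defP => H; have := H _; rewrite /minor.
suff -> : (\matrix_(i, j) toeplitz (fun k => P`_k) (r i) (c j)) =
          (\matrix_(i, j) toeplitz p (r i) (c j)).
  by apply=> z /(allP bs)/andP[_ /ltW].
by apply/matrixP => i j; rewrite !mxE /toeplitz coefP.
Qed.

(** * Alternating sums *)

Lemma alternating_sum_ge0 (R : realType) (e : nat -> R) (n : nat) :
  (forall i, 0 <= e i) -> (forall i, e i.+1 <= e i) ->
  0 <= \sum_(i < n) (-1) ^+ i * e i <= e 0%N.
Proof.
elim: n e => [|n IHn] e e0 emono; first by rewrite big_ord0 lexx e0.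
have /andP[] := IHn (fun i => e i.+1) (fun i => e0 _) (fun i => emono _).
rewrite big_ord_recl /= expr0 mul1r.
have -> : \sum_(i < n) (-1) ^+ (bump 0 i) * e (bump 0 i) =
          - \sum_(i < n) (-1) ^+ i * e i.+1.
  by rewrite -sumrN; apply: eq_bigr => i _; rewrite /bump add1n exprS; ring.
have := emono 0%N; lra.
Qed.

(** The ratio of consecutive terms cannot increase, so it stays at most 1.  The
    third hypothesis covers finitely supported sequences, for which
    log-concavity alone does not prevent a zero from being followed by a
    positive term. *)
Lemma log_concave_nonincreasing (R : realType) (e : nat -> R) :
  (forall i, 0 <= e i) -> (forall i, e i * e i.+2 <= e i.+1 ^+ 2) ->
  (forall i, e i = 0 -> e i.+1 = 0) -> e 1%N <= e 0%N ->
  forall i, e i.+1 <= e i.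
Proof.
move=> e0 elc ez e10; elim=> // i IHi.
have [z|nz] := eqVneq (e i) 0; first by rewrite !(ez, z).
have ei : 0 < e i by rewrite lt_def nz e0.
rewrite -(ler_pM2l ei) (le_trans (elc i)) // expr2.
by rewrite ler_wpM2r.
Qed.

Lemma alternating_sum_ge (R : realType) (e : nat -> R) (n : nat) :
  (forall i, 0 <= e i) -> (forall i, e i.+1 <= e i) ->
  (forall i, (n <= i)%N -> e i = 0) ->
  e 0%N - e 1%N + e 2%N - e 3%N <= \sum_(i < n) (-1) ^+ i * e i.
Proof.
move=> e0 emono ez.
have -> : \sum_(i < n) (-1) ^+ i * e i = \sum_(i < 4 + n) (-1) ^+ i * e i.
  rewrite -!(big_mkord xpredT (fun i => (-1) ^+ i * e i)).
  rewrite [RHS](big_cat_nat (n := n)) ?leq_addl //=.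
  rewrite [X in _ = _ + X]big_nat [X in _ = _ + X]big1 ?addr0 // => i /andP[/ez -> _].
  by rewrite mulr0.
rewrite big_split_ord /= !big_ord_recl big_ord0 /=.
have -> : \sum_(i < n) (-1) ^+ (4 + i) * e (4 + i)%N =
          \sum_(i < n) (-1) ^+ i * e i.+4.
  by apply: eq_bigr => i _; rewrite exprD (_ : (-1) ^+ 4 = 1 :> R) ?mul1r //;
     ring.
have /andP[] := @alternating_sum_ge0 R (fun i => e i.+4) n
  (fun i => e0 _) (fun i => emono _).
rewrite /bump /=; set S := \sum_(_ < _) _.
rewrite expr0 !exprS expr0; lra.
Qed.

(** The sum is read outwards from the j-th term in both directions, with signs
    normalised so that this term, counted twice, is positive. *)
Lemma alternating_sum_split (R : realType) (c : nat -> R) (j m : nat) :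
  (-1) ^+ j * \sum_(i < (j + m).+1) (-1) ^+ i * c i =
  \sum_(i < j.+1) (-1) ^+ i * c (j - i)%N
  + \sum_(i < m.+1) (-1) ^+ i * c (j + i)%N - c j.
Proof.
rewrite -addSn big_split_ord /= mulrDr.
rewrite [X in _ = _ + X - _]big_ord_recl /= addn0 expr0 mul1r.
rewrite -addrA [c j + _]addrC addrK; congr (_ + _).
  rewrite (reindex_inj rev_ord_inj) /= big_distrr; apply: eq_bigr => i _ /=.
  rewrite subSS mulrA -exprD; congr (_ * _).
  have lei : (i <= j)%N by rewrite -ltnS.
  by rewrite -signr_odd oddD oddB // addbA addbb addFb signr_odd.
rewrite big_distrr; apply: eq_bigr => i _ /=.
rewrite /bump add1n addSnnS mulrA -exprD; congr (_ * _).
by rewrite -signr_odd !oddD addbA addbb addFb signr_odd.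
Qed.

(** * Curvature and small Toeplitz minors *)

(** The value at 0 is the one obtained by extending f by 0 to negative indices,
    so that interior and boundary terms obey the same inequalities. *)
Definition curv (R : realType) (f : nat -> R) (i : nat) : R :=
  if i is i'.+1 then f i' * f i'.+2 / f i'.+1 ^+ 2 else 0.

Lemma det_two (R : comNzRingType) (F : nat -> nat -> R) :
  \det (\matrix_(i < 2, j < 2) F i j)
  = F 0%N 0%N * F 1%N 1%N - F 0%N 1%N * F 1%N 0%N.
Proof.
rewrite (expand_det_row _ ord0) !big_ord_recl big_ord0 /cofactor !det_mx11.
rewrite !mxE /= /bump /= !exprS !expr0; ring.
Qed.

Lemma det_three (R : comNzRingType) (F : nat -> nat -> R) :
  \det (\matrix_(i < 3, j < 3) F i j)
  = F 0%N 0%N * (F 1%N 1%N * F 2%N 2%N - F 1%N 2%N * F 2%N 1%N)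
    - F 0%N 1%N * (F 1%N 0%N * F 2%N 2%N - F 1%N 2%N * F 2%N 0%N)
    + F 0%N 2%N * (F 1%N 0%N * F 2%N 1%N - F 1%N 1%N * F 2%N 0%N).
Proof.
rewrite (expand_det_row _ ord0) !big_ord_recl big_ord0 /cofactor.
pose G k (i j : nat) := F i.+1 (bump k j).
have minorE (k : 'I_3) :
    row' ord0 (col' k (\matrix_(i < 3, j < 3) F i j)) =
    \matrix_(i < 2, j < 2) G k i j.
  by apply/matrixP => i j; rewrite !mxE.
rewrite !minorE !det_two !mxE /G /= /bump /= !exprS !expr0; ring.
Qed.

(** This is the minor on rows 0, 1 and columns i, i + 1. *)
Lemma curv_le1 (R : realType) (f : nat -> R) : (forall i, 0 < f i) ->
  totally_positive f -> forall i, curv f i <= 1.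
Proof.
move=> f0 tpf [|j] /=; first exact: ler01.
rewrite ler_pdivrMr ?exprn_gt0 // mul1r.
have inc1 : @increasing_idx 2 (fun i => i) by [].
have inc2 : @increasing_idx 2 (fun i => (j.+1 + i)%N).
  by move=> i i' ; rewrite ltn_add2l.
have := tpf 2%N _ _ inc1 inc2; rewrite /minor.
rewrite (det_two (fun i l => toeplitz f i (j.+1 + l))) /toeplitz /=.
rewrite !addn0 !addn1 !subn0 ?ltnS ?subSS ?subn0 ?leq0n.
rewrite -[f j * _ <= _]subr_ge0; congr (0 <= _); ring.
Qed.

(** The difference of the two sides is f_(i+1)^-3 times the minor on rows
    0, 1, 2 and columns i + 1, i + 2, i + 3.  Total positivity enters through
    this inequality: a curvature close to 1 forces at least one neighbouring
    curvature to be close to 1. *)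
Lemma curv_minor3 (R : realType) (f : nat -> R) : (forall i, 0 < f i) ->
  totally_positive f -> forall i,
  curv f i.+1 ^+ 2 * ((1 - curv f i) * (1 - curv f i.+2)) <= (1 - curv f i.+1) ^+ 2.
Proof.
move=> f0 tpf i.
have inc1 : @increasing_idx 3 (fun i => i) by [].
have inc2 : @increasing_idx 3 (fun l => (i.+1 + l)%N).
  by move=> l l' ; rewrite ltn_add2l.
have := tpf 3%N _ _ inc1 inc2; rewrite /minor.
rewrite (det_three (fun l m => toeplitz f l (i.+1 + m))) /toeplitz /=.
rewrite !addn0 !addn1 !addn2 ?subn0 ?ltnS ?subSS ?subn0 ?leq0n /=.
set D := (X in 0 <= X) => D_ge0; rewrite -subr_ge0.
suff -> : (1 - curv f i.+1) ^+ 2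
   - curv f i.+1 ^+ 2 * ((1 - curv f i) * (1 - curv f i.+2)) = D / f i.+1 ^+ 3.
  by rewrite divr_ge0 // exprn_ge0 // ltW.
have n0 k : f k != 0 by rewrite gt_eqF.
rewrite /D {D D_ge0}; case: i inc2 => [|i] inc2 /=.
  by field; rewrite !n0.
by rewrite !subSS !subn0; field; rewrite !n0.
Qed.

(** * One-sided tails of sequences of bounded curvature *)

(** Stated without division, so that it applies to coefficient sequences of
    polynomials and, read in either direction from a given term, to their
    tails.  Since such sequences vanish from some index on, internal
    zeros have to be excluded separately. *)
Definition curv_bounded (R : realType) (B : R) (e : nat -> R) : Prop :=
  [/\ forall i, 0 <= e i,
      forall i, e i * e i.+2 <= B * e i.+1 ^+ 2
    & forall i, e i = 0 -> e i.+1 = 0].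

Lemma curv_bounded_dilate (R : realType) (B x : R) (e : nat -> R) : 0 < x ->
  curv_bounded B e -> curv_bounded B (fun i => e i * x ^+ i).
Proof.
move=> x0 [e0 elc ez]; split=> i.
- by rewrite mulr_ge0 // exprn_ge0 // ltW.
- have -> : e i * x ^+ i * (e i.+2 * x ^+ i.+2) =
            e i * e i.+2 * x ^+ i.+1 ^+ 2 by rewrite !exprS; ring.
  rewrite [X in B * X]exprMn [leRHS]mulrA; apply: ler_wpM2r => //; exact: sqr_ge0.
- move/eqP; rewrite mulf_eq0 expf_eq0 (gt_eqF x0) andbF orbF => /eqP/ez ->.
  by rewrite mul0r.
Qed.

Lemma curv_bounded_shift (R : realType) (B : R) (e : nat -> R) (j : nat) :
  curv_bounded B e -> curv_bounded B (fun i => e (j + i)%N).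
Proof. by case=> e0 elc ez; split=> i; rewrite ?addnS //; apply: ez. Qed.

Lemma curv_bounded_reverse (R : realType) (B : R) (e : nat -> R) (j : nat) :
  0 <= B -> (forall i, (i <= j)%N -> 0 < e i) -> curv_bounded B e ->
  curv_bounded B (fun i => if (i <= j)%N then e (j - i)%N else 0).
Proof.
move=> B0 epos [e0 elc ez]; split=> i.
- by case: ifP.
- case: (leqP i.+2 j) => [lei|_]; last first.
    by rewrite mulr0 mulr_ge0 // sqr_ge0.
  rewrite !(ltnW lei) (ltnW (ltnW lei)) mulrC.
  have -> : (j - i.+1)%N = (j - i.+2).+1 by lia.
  have -> : (j - i)%N = (j - i.+2).+2 by lia.
  exact: elc.
- case: (leqP i j) => [lei|lti]; last by rewrite ltnNge ltnW.
  by move=> z; have := epos (j - i)%N (leq_subr _ _); rewrite z ltxx.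
Qed.

(** The constant 1 - 21/22 bounds B^2 y, which is at most (2/7)^2 (54/101). *)
Lemma third_term_le (R : realType) (B y : R) (e : nat -> R) :
  curv_bounded B e -> 0 < e 0%N -> e 1%N = y * e 0%N ->
  0 < y <= 54 / 101 -> B <= 2 / 7 ->
  e 3%N <= (1 - 21 / 22) * e 2%N.
Proof.
move=> [e_ge0 elc _] e0 e1 /andP[y0 yle] leB.
have e1_gt0 : 0 < e 1%N by rewrite e1 mulr_gt0.
have B_ge0 : 0 <= B.
  by rewrite -(pmulr_lge0 _ (exprn_gt0 2 e1_gt0)) (le_trans _ (elc 0%N)) ?mulr_ge0.
have e2 : e 2%N <= B * y * e 1%N.
  rewrite -(ler_pM2l e0) (le_trans (elc 0%N)) // e1; lra.
rewrite -(ler_pM2l e1_gt0) (le_trans (elc 1%N)) // expr2.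
have BBy : B * (B * y) <= 1 - 21 / 22.
  have B1 : B * B <= 2 / 7 * (2 / 7) by apply: ler_pM.
  rewrite mulrA; apply: le_trans (_ : 2 / 7 * (2 / 7) *
    (54 / 101) <= _).
    by apply: ler_pM => //; [apply: mulr_ge0 | apply: ltW].
  lra.
apply: le_trans (_ : B * (B * y * e 1%N * e 2%N) <= _).
  by apply: ler_wpM2l => //; apply: ler_wpM2r.
have -> : B * (B * y * e 1%N * e 2%N) = B * (B * y) * (e 1%N * e 2%N) by ring.
rewrite [leRHS]mulrCA; apply: ler_wpM2r => //.
by rewrite mulr_ge0 // ltW.
Qed.

(** Beyond the fourth term the tail is alternating with nonincreasing terms
    and starts with a plus sign, so it may be dropped; lam is the proportion of
    the third term that survives the subtraction of the fourth. *)
Lemma one_sided_bound (R : realType) (B y w lam : R) (e : nat -> R) (n : nat) :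
  curv_bounded B e -> B <= 1 -> 0 < e 0%N -> e 1%N = y * e 0%N -> y <= 1 ->
  e 2%N = w * y ^+ 2 * e 0%N -> e 3%N <= (1 - lam) * e 2%N ->
  (forall i, (n <= i)%N -> e i = 0) ->
  e 0%N * (1 - y + lam * w * y ^+ 2) <= \sum_(i < n) (-1) ^+ i * e i.
Proof.
move=> [e_ge0 elc ez] leB e0 e1 y1 e2 e3 en.
have emono : forall i, e i.+1 <= e i.
  apply: log_concave_nonincreasing => //; last first.
    by rewrite e1 ger_pMl.
  move=> i; apply: le_trans (elc i) _.
  by rewrite ler_piMl // sqr_ge0.
apply: le_trans (alternating_sum_ge e_ge0 emono en).
by move: e3; rewrite e2 e1; lra.
Qed.

(** * Numerical estimates *)

(** The fraction 54/101 lies just above sqrt (2/7) = 0.53452... *)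
Lemma le_54_101_of_sqr (R : realType) (y : R) : 0 <= y -> y ^+ 2 <= 2 / 7 -> y <= 54 / 101.
Proof.
move=> y0 y2; rewrite leNgt; apply/negP => hy.
have c0 : (0 : R) <= 54 / 101 by lra.
have := ltr_pM c0 c0 hy hy; rewrite -!expr2; lra.
Qed.

(** The left alternative is tight: at y = sqrt (2/7) the value 1 - 2 y + 12/49 y^2
    is about 0.0009.  The powers of y are bounded below by their tangents at
    y = 54/101, after which the claims are linear in y. *)
Lemma balanced_value_gt0 (R : realType) (A y S : R) :
  1 / 2 < y -> y ^+ 2 <= 2 / 7 -> y ^+ 2 <= A ->
  12 / 49 <= S \/ 14 / 15 * A <= S ->
  0 < 1 - 2 * y + y ^+ 2 * S.
Proof.
move=> ylo y2 yA SP.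
have y0 : 0 <= y by lra.
have yhi : y <= 54 / 101 by apply: le_54_101_of_sqr.
have tan : 2 * (54 / 101) * y - (54 / 101) ^+ 2 <= y ^+ 2.
  by rewrite -subr_ge0 (_ : _ - _ = (y - 54 / 101) ^+ 2) ?sqr_ge0 //; ring.
case: SP => leS.
  have : y ^+ 2 * (12 / 49) <= y ^+ 2 * S by apply: ler_wpM2l => //; exact: sqr_ge0.
  lra.
have h1 : y ^+ 2 * (14 / 15 * y ^+ 2) <= y ^+ 2 * S.
  apply: ler_wpM2l; first exact: sqr_ge0.
  by lra.
have h2 : 2 * (54 / 101) ^+ 2 * y ^+ 2 - (54 / 101) ^+ 4 <= y ^+ 2 * y ^+ 2.
  by rewrite -subr_ge0 (_ : _ - _ = (y ^+ 2 - (54 / 101) ^+ 2) ^+ 2) ?sqr_ge0 //; ring.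
lra.
Qed.

(** From A <= 2/7 and A u > 1/4 we get u > 7/8, so the product of the defects
    1 - um and 1 - up is at most ((1/8) / (7/8))^2 = 1/49.  Since both lie in
    [0, 1], their sum is at most 1 plus their product. *)
Lemma neighbour_curv_sum (R : realType) (A u up um : R) :
  A <= 2 / 7 -> 1 / 4 < A * u -> u <= 1 -> 0 <= A ->
  up <= 1 -> um <= 1 -> 0 <= up -> 0 <= um ->
  u ^+ 2 * ((1 - um) * (1 - up)) <= (1 - u) ^+ 2 ->
  48 / 49 <= up + um.
Proof.
move=> leA Au u1 A0 up1 um1 up0 um0 h.
have u0 : 0 <= u by rewrite leNgt; apply/negP => u0; have := mulr_ge0_le0 A0 (ltW u0); lra.
have ulo : 7 / 8 <= u by have := ler_wpM2r u0 leA; lra.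
have prod0 : 0 <= (1 - um) * (1 - up) by rewrite mulr_ge0 // subr_ge0.
have h1 : (7 / 8) ^+ 2 * ((1 - um) * (1 - up)) <= (1 - 7 / 8) ^+ 2.
  apply: le_trans (le_trans h _).
    by apply: ler_wpM2r => //; rewrite ler_pXn2r ?nnegrE //; lra.
  by rewrite ler_pXn2r ?nnegrE //; lra.
have : (1 - um) * (1 - up) <= 1 / 49 by lra.
have := mulr_ge0 um0 up0; lra.
Qed.

(** If y <= 1/2, any positive second-order contribution is enough; the quantitative
    hypothesis is only called upon when y > 1/2. *)
Lemma balanced_value_case (R : realType) (A u y w v lam : R) :
  0 < y -> y ^+ 2 = A * u -> 0 <= u <= 1 -> 0 <= A <= 2 / 7 ->
  0 < lam * w + 21 / 22 * v ->
  (1 / 4 < A * u ->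
     12 / 49 <= lam * w + 21 / 22 * v \/ 14 / 15 * A <= lam * w + 21 / 22 * v) ->
  0 < 1 - 2 * y + A * u * (lam * w + 21 / 22 * v).
Proof.
move=> y0 y2 /andP[u0 u1] /andP[A0 leA] S0 HS.
rewrite -y2 in HS *; have [yhalf|yhalf] := ltrP (1 / 2) y.
  have yq : 1 / 4 < y ^+ 2.
    have h : (0 : R) <= 1 / 2 by lra.
    by have := ltr_pM h h yhalf yhalf; rewrite -expr2; lra.
  have leA2 : y ^+ 2 <= A by rewrite y2 ler_piMr.
  exact: (balanced_value_gt0 yhalf (le_trans leA2 leA) leA2 (HS yq)).
have : 0 < y ^+ 2 * (lam * w + 21 / 22 * v).
  by rewrite mulr_gt0 // exprn_gt0.
lra.
Qed.

(** * Sign of the polynomial at the sample points *)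

(** The hypotheses on x say that the two neighbours of the term of index j + 1
    both equal y times this term.  The choice lam = 1 is for the penultimate
    interior index of a polynomial: there nothing follows the second
    neighbour on the right, and the estimate at that index has no slack for the
    factor 21/22. *)
Lemma balanced_bound (R : realType) (B y x lam : R) (p : nat -> R) (d j : nat) :
  curv_bounded B p -> B <= 2 / 7 ->
  (forall i, (i <= d)%N -> 0 < p i) -> (forall i, (d < i)%N -> p i = 0) ->
  (j.+1 < d)%N -> 0 < y <= 54 / 101 -> 0 < x ->
  p j.+2 * x = y * p j.+1 -> p j = y * x * p j.+1 ->
  (lam = 21 / 22) \/ (lam = 1 /\ p j.+4 = 0) ->
  p j.+1 * x ^+ j.+1 *
    (1 - 2 * y
     + y ^+ 2 * (lam * curv p j.+2 + 21 / 22 * curv p j))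
  <= (-1) ^+ j.+1 * \sum_(i < d.+1) (-1) ^+ i * (p i * x ^+ i).
Proof.
move=> cbp leB ppos pzero ltjd yb x0 pj2 pj lamP.
have /andP[y0 yle] := yb.
have B1 : B <= 1 by lra.
have B0 : 0 <= B.
  have [e0 elc _] := cbp.
  have p1 : 0 < p 1%N by apply: ppos; apply: leq_trans ltjd.
  by rewrite -(pmulr_lge0 _ (exprn_gt0 2 p1)) (le_trans _ (elc 0%N)) ?mulr_ge0.
have y1 : y <= 1 by lra.
pose c i := p i * x ^+ i.
have cbc : curv_bounded B c by apply: curv_bounded_dilate.
have cpos i : (i <= d)%N -> 0 < c i.
  by move=> lei; rewrite mulr_gt0 ?exprn_gt0 ?ppos.
have pj1 : 0 < p j.+1 by exact: ppos (ltnW ltjd).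
have pj0 : 0 < p j := ppos _ (ltnW (ltnW ltjd)).
have pj2_gt0 : 0 < p j.+2 := ppos _ ltjd.
have cj1 : 0 < c j.+1 := cpos _ (ltnW ltjd).
pose m := (d - j.+1)%N.
have dE : (j.+1 + m)%N = d by apply: subnKC; apply: ltnW.
rewrite -[in d.+1]dE.
rewrite (alternating_sum_split c).
set S1 := (\sum_(i < j.+2) _); set S2 := (\sum_(i < m.+1) _).
have bS2 : c j.+1 * (1 - y + lam * curv p j.+2 * y ^+ 2) <= S2.
  pose e i := c (j.+1 + i)%N.
  have cbe : curv_bounded B e by apply: curv_bounded_shift.
  have e1 : e 1%N = y * e 0%N.
    rewrite /e /c addn0 addn1 exprS.
    by rewrite mulrA [p _ * x]pj2 mulrA.
  rewrite (_ : c j.+1 = e 0%N); last by rewrite /e addn0.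
  apply: (one_sided_bound cbe B1 _ e1 y1).
  - by rewrite /e addn0.
  - rewrite /e /c addn0 addn2 /= !exprS.
    have -> : y = p j.+2 * x / p j.+1 by rewrite pj2 mulfK // gt_eqF.
    by field; rewrite !gt_eqF.
  - have [->|[-> p4]] := lamP.
      by apply: (third_term_le cbe _ e1 yb) => //; rewrite /e addn0.
    by rewrite /e /c addn3 p4 mul0r subrr mul0r.
  - by move=> i lti; rewrite /e /c pzero ?mul0r // -dE -addnS leq_add2l.
have bS1 : c j.+1 * (1 - y + 21 / 22 * curv p j * y ^+ 2) <= S1.
  pose e i := if (i <= j.+1)%N then c (j.+1 - i)%N else 0.
  have cbe : curv_bounded B e.
    by apply: curv_bounded_reverse => // i lei; apply/cpos/(leq_trans lei)/ltnW.
  have e00 : e 0%N = c j.+1 by rewrite /e /= subn0.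
  have e0_gt0 : 0 < e 0%N by rewrite e00.
  have e1 : e 1%N = y * e 0%N.
    by rewrite e00 /e /= subSS subn0 /c pj exprS; ring.
  have -> : S1 = \sum_(i < j.+2) (-1) ^+ i * e i.
    by apply: eq_bigr => i _; rewrite /e -ltnS ltn_ord.
  rewrite -e00; apply: (one_sided_bound cbe B1) => //.
  - rewrite e00 /e; case: (j) pj pj0 pj1 => [|i] pi pi0 pi1 /=.
      by rewrite !mul0r.
    rewrite !subSS subn0 /c !exprS.
    rewrite /= in pi.
    have -> : y = p i.+1 / (x * p i.+2).
      by rewrite pi; field; rewrite !gt_eqF.
    by field; rewrite !gt_eqF.
  - by apply: (third_term_le cbe _ e1 yb).
  - by move=> i lti; rewrite /e leqNgt lti.
move: bS1 bS2; rewrite -/(c j.+1); set u := curv p j; set v := curv p j.+2.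
lra.
Qed.

(** At this point the leading term is twice the next one, which is enough for it
    to determine the sign: an explicit substitute for the limit at infinity. *)
Lemma leading_term_dominates (R : realType) (B x : R) (p : nat -> R) (d : nat) :
  curv_bounded B p -> 0 <= B <= 2 / 7 ->
  (forall i, (i <= d.+1)%N -> 0 < p i) -> 0 < x ->
  p d.+1 * x = 2 * p d ->
  0 < (-1) ^+ d.+1 * \sum_(i < d.+2) (-1) ^+ i * (p i * x ^+ i).
Proof.
move=> cbp /andP[B0 leB] ppos x0 px.
pose c i := p i * x ^+ i.
have cbc : curv_bounded B c by apply: curv_bounded_dilate.
have cpos i : (i <= d.+1)%N -> 0 < c i.
  by move=> lei; rewrite mulr_gt0 ?exprn_gt0 ?ppos.
have dE : (d.+1 + 0)%N = d.+1 by rewrite addn0.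
rewrite -[in d.+2]dE (alternating_sum_split c).
rewrite [X in _ + X - _]big_ord1 /= expr0 mul1r !addn0 addrK.
pose e i := if (i <= d.+1)%N then c (d.+1 - i)%N else 0.
have cbe : curv_bounded B e by apply: curv_bounded_reverse.
have e0_gt0 : 0 < e 0%N by rewrite /e /= subn0 cpos.
have e1 : e 1%N = 1 / 2 * e 0%N.
  have pd : p d = 1 / 2 * (p d.+1 * x) by rewrite px; field.
  by rewrite /e /= subSS !subn0 /c exprS pd; ring.
have y_gt0 : 0 < 1 / 2 :> R by lra.
have y_le : 1 / 2 <= 54 / 101 :> R by lra.
have yb : 0 < (1 / 2 : R) <= 54 / 101.
  by rewrite y_gt0 y_le.
have -> : \sum_(i < d.+2) (-1) ^+ i * c (d.+1 - i)%N =
          \sum_(i < d.+2) (-1) ^+ i * e i.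
  by apply: eq_bigr => i _; rewrite /e -ltnS ltn_ord.
pose w := e 2%N / ((1 / 2) ^+ 2 * e 0%N).
have w0 : 0 <= w.
  case: (cbe) => e_ge0 _ _.
  by apply: divr_ge0 => //; apply: mulr_ge0 => //; apply: sqr_ge0.
have h := third_term_le cbe e0_gt0 e1 yb leB.
apply: lt_le_trans (one_sided_bound (w := w) cbe _ e0_gt0 e1 _ _ h _).
- apply: mulr_gt0 => //; lra.
- lra.
- lra.
- by rewrite /w; field; rewrite gt_eqF.
- by move=> i lti; rewrite /e leqNgt lti.
Qed.

Section BalancePoint.
Variables (R : realType) (p : nat -> R) (j : nat).
Hypotheses (p0 : 0 < p j) (p1 : 0 < p j.+1) (p2 : 0 < p j.+2).

(** The positive x with p_j x^j = p_(j+2) x^(j+2), that is x^2 = p_j / p_(j+2). *)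
Definition balance_point : R := Num.sqrt (curv p j.+1) * p j.+1 / p j.+2.

Lemma curv_gt0 : 0 < curv p j.+1.
Proof. by rewrite /= divr_gt0 ?mulr_gt0 ?exprn_gt0. Qed.

Lemma sqrt_curvK : Num.sqrt (curv p j.+1) ^+ 2 = curv p j.+1.
Proof. by rewrite sqr_sqrtr // ltW // curv_gt0. Qed.

Lemma sqrt_curv_gt0 : 0 < Num.sqrt (curv p j.+1).
Proof. by rewrite sqrtr_gt0 curv_gt0. Qed.

Lemma balance_point_gt0 : 0 < balance_point.
Proof. by rewrite divr_gt0 ?mulr_gt0 ?sqrt_curv_gt0. Qed.

Lemma balance_right : p j.+2 * balance_point = Num.sqrt (curv p j.+1) * p j.+1.
Proof. by rewrite mulrC divfK // gt_eqF. Qed.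

Lemma balance_left : p j = Num.sqrt (curv p j.+1) * balance_point * p j.+1.
Proof.
rewrite /balance_point !mulrA -expr2 sqrt_curvK /=.
by field; rewrite !gt_eqF.
Qed.

Hypothesis curv_lt1 : curv p j.+1 < 1.

(** Together with [balance_point_gt], this interlaces the balance points with the
    ratios p_j / p_(j+1); in particular the balance points increase with j. *)
Lemma balance_point_lt : balance_point < p j.+1 / p j.+2.
Proof.
rewrite ltr_pM2r ?invr_gt0 // gtr_pMl //.
by rewrite -sqrtr1 ltr_sqrt.
Qed.

Lemma balance_point_gt : p j / p j.+1 < balance_point.
Proof.
rewrite {1}balance_left mulfK ?gt_eqF // gtr_pMl ?balance_point_gt0 //.
by rewrite -sqrtr1 ltr_sqrt.
Qed.

End BalancePoint.

(** The sign pattern is sampled at 0, at the balance points, and at a point where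
    the leading term dominates. *)
Lemma tp_of_balanced_values (R : realType) (p : nat -> R) (d : nat) :
  curv_bounded (2 / 7) p ->
  (forall i, (i <= d.+1)%N -> 0 < p i) -> (forall i, (d.+1 < i)%N -> p i = 0) ->
  (forall j, (j < d)%N -> exists2 lam,
     (lam = 21 / 22) \/ (lam = 1 /\ p j.+4 = 0) &
     0 < 1 - 2 * Num.sqrt (curv p j.+1)
         + curv p j.+1 * (lam * curv p j.+2 + 21 / 22 * curv p j)) ->
  totally_positive p.
Proof.
move=> cbp ppos pzero bal.
pose x j := if j is j'.+1 then
    (if (j' < d)%N then balance_point p j' else 2 * (p d / p d.+1)) else 0.
have lc j : (j < d)%N -> curv p j.+1 <= 2 / 7.
  move=> ltj; have [_ elc _] := cbp.
  by rewrite /= ler_pdivrMr ?exprn_gt0 ?ppos // ltnW.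
have lt1 j : (j < d)%N -> curv p j.+1 < 1.
  by move/lc=> h; apply: le_lt_trans h _; lra.
have P0 j : (j < d)%N -> 0 < p j by move=> h; rewrite ppos // ltnW // ltnW.
have P1 j : (j < d)%N -> 0 < p j.+1 by move=> h; rewrite ppos // ltnW.
have P2 j : (j < d)%N -> 0 < p j.+2 by move=> h; rewrite ppos.
apply: (@tp_of_alternation R p x d.+1) => //.
- exact: ppos.
- case=> [|j]; rewrite /x /=.
    have [d0 _|d_gt0 _] := leqP d 0.
      by rewrite mulr_gt0 // divr_gt0 ?ppos.
    by apply: balance_point_gt0; [apply: P0 | apply: P1 | apply: P2].
  rewrite ltnS => ltj; rewrite ltj.
  have h := balance_point_lt (P1 _ ltj) (P2 _ ltj) (lt1 _ ltj).
  have [ltj1|lej1] := ltnP.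
    apply: lt_trans h _.
    exact: balance_point_gt (P0 _ ltj1) (P1 _ ltj1) (P2 _ ltj1) (lt1 _ ltj1).
  have -> : d = j.+1 by apply/eqP; rewrite eqn_leq lej1 ltj.
  apply: lt_trans h _; rewrite ltr_pMl ?ltr1n //.
  by rewrite divr_gt0 ?(P1 _ ltj) ?(P2 _ ltj).
case=> [|j] lej.
  rewrite expr0 mul1r big_ord_recl big1 ?addr0 => [|i _].
    by rewrite /= expr0 !mul1r mulr1 ppos.
  by rewrite [x 0%N]/= expr0n /= !mulr0.
rewrite /x; case: ltnP => [ltj|gej]; last first.
  have -> : j = d by apply/eqP; rewrite eqn_leq gej -ltnS lej.
  have pd : 0 < p d by rewrite ppos.
  have pd1 : 0 < p d.+1 by rewrite ppos.
  apply: (leading_term_dominates cbp) => //.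
  - by rewrite lexx andbT; lra.
  - by rewrite mulr_gt0 // divr_gt0.
  - by field; rewrite gt_eqF.
have [lam lamP bgt0] := bal j ltj.
have Q0 := P0 _ ltj; have Q1 := P1 _ ltj; have Q2 := P2 _ ltj.
have s0 := sqrt_curv_gt0 Q0 Q1 Q2.
have s2 := sqrt_curvK Q0 Q1 Q2.
have yb : 0 < Num.sqrt (curv p j.+1) <= 54 / 101.
  by rewrite s0 le_54_101_of_sqr ?(ltW s0) // s2 lc.
have X0 := balance_point_gt0 Q0 Q1 Q2.
have XR := balance_right Q2.
have XL := balance_left Q0 Q1 Q2.
have ltjd : (j.+1 < d.+1)%N by [].
apply: lt_le_trans (balanced_bound cbp (lexx _) ppos pzero ltjd yb X0 XR XL lamP).
by rewrite s2 mulr_gt0 // mulr_gt0 ?exprn_gt0.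
Qed.

(** * Truncation with a terminal curvature of one quarter *)

(** The coefficient of index k + 2 is the one that makes the curvature at k + 1
    equal to 1/4.  This value is small enough for y <= 1/2 at index k + 1, and
    at least a quarter of any curvature of a totally positive sequence, as the
    estimate at index k requires. *)
Definition trunc (R : realType) (b : nat -> R) (k i : nat) : R :=
  if (i <= k.+1)%N then b i
  else if i == k.+2 then b k.+1 ^+ 2 / (4 * b k) else 0.

Section Trunc.
Variables (R : realType) (b : nat -> R) (k : nat).
Hypothesis b_gt0 : forall i, 0 < b i.

Lemma trunc_low i : (i <= k.+1)%N -> trunc b k i = b i.
Proof. by rewrite /trunc => ->. Qed.

Lemma trunc_last : trunc b k k.+2 = b k.+1 ^+ 2 / (4 * b k).
Proof. by rewrite /trunc ltnn eqxx. Qed.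

Lemma trunc_high i : (k.+2 < i)%N -> trunc b k i = 0.
Proof. by move=> lti; rewrite /trunc leqNgt ltnW //= gtn_eqF. Qed.

Lemma trunc_gt0 i : (i <= k.+2)%N -> 0 < trunc b k i.
Proof.
rewrite leq_eqVlt => /predU1P[->|lei]; last by rewrite trunc_low.
by rewrite trunc_last divr_gt0 ?exprn_gt0 ?mulr_gt0.
Qed.

Lemma curv_trunc_low i : (i <= k)%N -> curv (trunc b k) i = curv b i.
Proof.
case: i => // i lei /=; rewrite !trunc_low //.
- by rewrite ltnW.
- by rewrite ltnW // ltnW.
Qed.

Lemma curv_trunc_last : curv (trunc b k) k.+1 = 1 / 4.
Proof.
rewrite /= trunc_last !trunc_low //.
by field; rewrite !gt_eqF.
Qed.

Lemma curv_trunc_high i : (k.+1 < i)%N -> curv (trunc b k) i = 0.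
Proof.
by case: i => // i lti /=; rewrite [trunc b k i.+2]trunc_high ?mulr0 ?mul0r.
Qed.

Lemma trunc_curv_bounded (B : R) : 1 / 4 <= B ->
  (forall i, curv b i <= B) -> curv_bounded B (trunc b k).
Proof.
move=> leB cb; have t0 i : 0 <= trunc b k i.
  by have [/trunc_gt0/ltW//|/trunc_high->] := leqP i k.+2.
split=> // i.
- have [lei|lti] := leqP i.+2 k.+2; last first.
    rewrite (@trunc_high i.+2) // mulr0 mulr_ge0 ?sqr_ge0 //; lra.
  rewrite -ler_pdivrMr ?exprn_gt0 ?trunc_gt0 //; last exact: ltnW.
  rewrite -[leLHS]/(curv (trunc b k) i.+1).
  have [lei'|] := leqP i.+1 k; first by rewrite curv_trunc_low.
  move=> gei; have -> : i = k by apply/eqP; rewrite eqn_leq; apply/andP; split.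
  by rewrite curv_trunc_last.
- have [lei|lti _] := leqP i k.+2; last by rewrite trunc_high // ltnW.
  by have := trunc_gt0 lei => /[swap] ->; rewrite ltxx.
Qed.

End Trunc.

(** * Damping the curvature *)

Lemma curv_ge0 (R : realType) (f : nat -> R) : (forall i, 0 < f i) ->
  forall i, 0 <= curv f i.
Proof. by move=> f0 [|i] //=; rewrite ltW // divr_gt0 ?mulr_gt0 ?exprn_gt0. Qed.

(** The sign condition is checked at three kinds of indices.  At the last one,
    k + 1, y is exactly 1/2 and the left neighbour supplies a positive
    contribution.  At index k the right neighbour has the imposed curvature 1/4
    instead of A u_(k+1).  Everywhere else both neighbours are genuine. *)
Lemma tp_of_damped_curvature (R : realType) (f b : nat -> R) (A : R) :
  (forall i, 0 < f i) -> totally_positive f -> 0 < A <= 2 / 7 ->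
  (forall i, 0 < b i) -> (forall i, curv b i = A * curv f i) ->
  totally_positive b.
Proof.
move=> f0 tpf /andP[A0 leA] b0 bf n r c incr incc.
(* The minor involves coefficients of index at most max c; the successor keeps
   k positive, so that index k + 1 has a left neighbour of positive curvature. *)
pose k := (\max_(i < n) c i).+1.
have lek i : (c i <= k)%N by apply: leqW; apply: leq_bigmax.
suff tpk : totally_positive (trunc b k).
  have := tpk n r c incr incc; congr (0 <= \det _); apply/matrixP => i j.
  rewrite !mxE /toeplitz trunc_low // (leq_trans (leq_subr _ _)) //.
  exact: leqW.
have fu0 := curv_ge0 f0; have fu1 := curv_le1 f0 tpf.
have fgt0 i : 0 < curv f i.+1 by apply: curv_gt0.
have cb i : curv b i <= 2 / 7.
  by rewrite bf; have := ler_piMr (ltW A0) (fu1 i); lra.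
apply: (@tp_of_balanced_values R _ k.+1).
- by apply: trunc_curv_bounded => //; lra.
- by move=> i; apply: trunc_gt0.
- by move=> i; apply: trunc_high.
move=> j; rewrite ltnS leq_eqVlt => /predU1P[->|ltj].
  exists (21 / 22); first by left.
  rewrite curv_trunc_last // curv_trunc_high // curv_trunc_low // bf.
  have -> : Num.sqrt (1 / 4) = 1 / 2 :> R.
    rewrite (_ : 1 / 4 = (1 / 2) ^+ 2); last by field.
    rewrite sqrtr_sqr ger0_norm //; lra.
  have := mulr_gt0 A0 (fgt0 (\max_(i < n) c i)); rewrite -/k; lra.
rewrite (curv_trunc_low b ltj) (curv_trunc_low b (ltnW ltj)) !bf.
have uP : 0 <= curv f j.+1 <= 1 by rewrite fu0 fu1.
have AP : 0 <= A <= 2 / 7 by rewrite ltW.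
have y2 : Num.sqrt (A * curv f j.+1) ^+ 2 = A * curv f j.+1.
  by rewrite sqr_sqrtr // mulr_ge0 // ltW.
have y0 : 0 < Num.sqrt (A * curv f j.+1) by rewrite sqrtr_gt0 mulr_gt0.
have v0 : 0 <= A * curv f j by rewrite mulr_ge0 // ltW.
have sumP (h : 1 / 4 < A * curv f j.+1) :=
  neighbour_curv_sum leA h (fu1 j.+1) (ltW A0) (fu1 j.+2) (fu1 j)
    (fu0 j.+2) (fu0 j) (curv_minor3 f0 tpf j).
have [ltj1|] := leqP j.+2 k.
  exists (21 / 22); first by left.
  rewrite (curv_trunc_low b ltj1) bf.
  apply: (balanced_value_case y0 y2 uP AP).
    by have := mulr_gt0 A0 (fgt0 j.+1); lra.
  move=> /sumP s; right.
  have := ler_wpM2l (ltW A0) s; lra.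
rewrite ltnS => gej.
have jk : k = j.+1 by apply/eqP; rewrite eqn_leq gej ltj.
exists 1; first by right; split=> //; apply: trunc_high; rewrite jk.
have -> : curv (trunc b k) j.+2 = 1 / 4 by rewrite -jk curv_trunc_last.
apply: (balanced_value_case y0 y2 uP AP); first lra.
(* The weights of the right and left curvatures are 1/4 and 21/22 A.  Multiplied by
   48/49, the smaller one is 12/49 or at least 14/15 A. *)
move=> /sumP s; have [leAq|ltAq] := lerP (1 / 4) (21 / 22 * A).
  left; have := ler_wpM2r (fu0 j) leAq; have := fu1 j.+2; lra.
right; have := ler_wpM2l (ltW A0) s.
have := ler_wpM2r (fu0 j.+2) (ltW ltAq); have := fu1 j.+2; lra.
Qed.

Theorem theorem1p18 (R : realType) (q : nat -> R)
    (q_gt0 : forall k : nat, (2 <= k)%N -> 0 < q k)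
    (tp_f : totally_positive (qseries q))
    (a : R) (a_gt1 : 1 < a) (a2_ge : 3503%:R / 1000%:R <= a ^+ 2) :
  (forall k : nat,
     hadamard (qseries q) (partial_theta a) k = qseries_theta a q k) /\
  totally_positive (hadamard (qseries q) (partial_theta a)).
Proof.
have a0 : 0 < a by apply: lt_trans a_gt1.
split=> [k|].
  rewrite /hadamard /qseries /qseries_theta /partial_theta.
  by case: k => [|[|k]] /=; rewrite ?muln0 ?mul0n ?subnn ?expr0 ?invr1 ?mulr1 // invfM mulrC.
have f_gt0 k : 0 < qseries q k.
  rewrite /qseries; case: ifP => // _; rewrite invr_gt0.
  by rewrite /qprod big_nat prodr_gt0 // => j /andP[le2j _]; rewrite exprn_gt0 ?q_gt0.
have t_gt0 k : 0 < partial_theta a k by rewrite invr_gt0 exprn_gt0.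
apply: (@tp_of_damped_curvature R (qseries q) _ (a ^+ 2)^-1) => //.
- rewrite invr_gt0 exprn_gt0 //=.
  have h : 7 / 2 <= a ^+ 2 by apply: le_trans a2_ge; lra.
  rewrite -[2 / 7]invf_div lef_pV2 ?posrE ?exprn_gt0 //; lra.
- by move=> k; rewrite mulr_gt0.
case=> [|k] /=; first by rewrite mulr0.
rewrite /hadamard.
have thetaE : partial_theta a k * partial_theta a k.+2
    = (a ^+ 2)^-1 * partial_theta a k.+1 ^+ 2.
  rewrite /partial_theta exprVn -!invfM -!exprM -!exprD; congr (_ ^+ _)^-1.
  nia.
rewrite mulrACA thetaE exprMn.
by field; rewrite !gt_eqF.
Qed.
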